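(* The function $K_2$ is continuous on $\big([0,1]\times[0,1]\big)\setminus\{(0,0)\}$.
   Context: Let $K:[0,1]\times[0,1]\to\mathbb R$ be defined by $K(x,y)=\frac12-\{(xy)^{-1}\}$ if $0<x,y\le 1$, and $K(x,y)=0$ if $0\le x,y\le1$ and $xy=0$, where $\{\alpha\}=\alpha-\lfloor\alpha\rfloor$. Define $K_2(x,y)=\int_0^1K(x,z)K(z,y)\,dz$ for $0\le x,y\le1$. *)

(* Defs.v *)
From HB Require Import structures.
From mathcomp Require Import all_boot all_order all_algebra.
From mathcomp Require Import all_classical all_reals all_analysis.
Set Implicit Arguments. Unset Strict Implicit. Unset Printing Implicit Defensive.
Import Order.TTheory GRing.Theory Num.Theory.
Import numFieldNormedType.Exports.
Local Open Scope classical_set_scope.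
Local Open Scope ring_scope.

Definition fracpart (R : realType) (a : R) : R := a - (Num.floor a)%:~R.

Definition K (R : realType) (x y : R) : R :=
  if (0 < x) && (0 < y) then 2^-1 - fracpart ((x * y)^-1) else 0.

Definition K2 (R : realType) (x y : R) : R :=
  Rintegral (@lebesgue_measure R) `[0, 1]%classic (fun z => K x z * K z y).

Definition D0 (R : realType) : set (R * R) :=
  [set p | 0 <= p.1 <= 1 /\ 0 <= p.2 <= 1 /\ p <> (0, 0)].

(* Main.v *)
(** For [y != 0] the map [y |-> K y] is continuous into [L^1([0, 1])], so that
[K2 x y'] tends to [K2 x y] as [y'] tends to [y], uniformly in [x]. By symmetry
it remains to see that [K2 x y] tends to [0 = K2 0 y] as [x] tends to [0] from
the right, a Riemann-Lebesgue statement: [K x] oscillates faster and faster, so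
its integral against [g = K ^~ y] tends to [0].

Cut the half-line into the cells on which [floor (1 / (x z))] is constant. There
[K x z] differs by at most [x z] from an affine function of [z] with mean [0] on
the cell. Multiplied by the value of [g] at the right end of the cell, this
affine function still has integral [0]; and this value tends to [g z] at every
point [z] of continuity, as the cell containing [z] shrinks to [z]. *)

Require Import Defs.
From HB Require Import structures.
From mathcomp Require Import all_boot all_order all_algebra.
From mathcomp Require Import all_classical all_reals all_analysis.
From mathcomp Require Import measurable_realfun ring lra.
Import Order.TTheory GRing.Theory Num.Theory.
Import numFieldNormedType.Exports.
Local Open Scope classical_set_scope.
Local Open Scope ring_scope.
Set Implicit Arguments. Unset Strict Implicit. Unset Printing Implicit Defensive.

Section bounded_convergence.
Context d (T : measurableType d) (R : realType).
Variables (nu : {measure set T -> \bar R}) (D : set T) (M : R).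
Hypotheses (mD : measurable D) (nuD : (nu D < +oo)%E).

Lemma normr_le_integrable (f : T -> R) : measurable_fun D f ->
  (forall z, D z -> `|f z| <= M) -> nu.-integrable D (EFin \o f).
Proof.
move=> mf fM; apply: measurable_bounded_integrable => //.
exists M; split; first exact: num_real.
by move=> N /ltW MN z Dz /=; exact: le_trans (fM z Dz) MN.
Qed.

Lemma bounded_convergence (f_ : nat -> T -> R) (f : T -> R) :
  (forall n, measurable_fun D (f_ n)) -> measurable_fun D f ->
  (forall n z, D z -> `|f_ n z| <= M) ->
  {ae nu, forall z, D z -> f_ ^~ z @ \oo --> f z} ->
  \int[nu]_(z in D) f_ n z @[n --> \oo] --> \int[nu]_(z in D) f z.
Proof.
move=> mf_ mf f_M f_f.
have [] := @dominated_convergence _ _ _ nu _ mD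
  (fun n => EFin \o f_ n) (EFin \o f) (EFin \o cst `|M|).
- by move=> n; apply/measurable_EFinP; exact: mf_.
- exact/measurable_EFinP.
- apply: filterS f_f => z f_fz Dz.
  by apply/cvg_EFin; [exact: nearW|exact: f_fz].
- by apply: measurable_bounded_integrable => //; exact: bounded_cst.
- apply: aeW => z n Dz /=; rewrite lee_fin.
  exact: le_trans (f_M n z Dz) (ler_norm _).
move=> f_integrable _ cvg_f; apply: fine_cvg; rewrite fineK; first exact: cvg_f.
exact: integrable_fin_num.
Qed.

Corollary bounded_convergence0 (f_ : nat -> T -> R) :
  (forall n, measurable_fun D (f_ n)) ->
  (forall n z, D z -> `|f_ n z| <= M) ->
  {ae nu, forall z, D z -> f_ ^~ z @ \oo --> (0 : R)} ->
  \int[nu]_(z in D) f_ n z @[n --> \oo] --> (0 : R).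
Proof.
move=> mf_ f_M f_0.
have := bounded_convergence mf_ (measurable_cst (0 : R)) f_M f_0.
by rewrite Rintegral_cst// mul0r.
Qed.

End bounded_convergence.

Section lebesgue_measure_itv.
Context {R : realType}.
Local Notation mu := (@lebesgue_measure R).

Lemma ae_neq (a : R) : {ae mu, forall z : R, z != a}.
Proof.
exists [set a]; split; first exact: measurable_set1.
  exact: lebesgue_measure_set1.
by move=> z /= /negP/negPn/eqP.
Qed.

Lemma lebesgue_measure_itvcc_lty (a b : R) : (mu `[a, b] < +oo)%E.
Proof.
by rewrite lebesgue_measure_itv; case: ifP => _; rewrite -?EFinB ltry.
Qed.

Lemma Rintegral_affine (a b p q : R) : a < b ->
  \int[mu]_(z in `]a, b]) (p + q * z) = (b - a) * (p + q * ((a + b) / 2)).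
Proof.
move=> ab.
have affine_continuous : continuous (fun z : R => p + q * z).
  move=> z; apply: cvgD; first exact: cvg_cst.
  by apply: cvgM; [exact: cvg_cst|exact: cvg_id].
have affine_integrable : mu.-integrable `[a, b] (EFin \o (fun z => p + q * z)).
  apply: continuous_compact_integrable; first exact: segment_compact.
  exact: continuous_subspaceT.
rewrite Rintegral_itv_obnd_cbnd; last first.
  by apply: integrableS affine_integrable => //; exact: subset_itv_oc_cc.
pose F (z : R) : R := p * z + q / 2 * z ^+ 2.
have dF (z : R) : is_derive z 1 F (p + q * z).
  by apply: is_derive_eq; rewrite /GRing.scale /=; lra.
have F_continuous : continuous F.
  by move=> z; apply/differentiable_continuous/derivable1_diffP.
rewrite /Rintegral (@continuous_FTC2 _ _ F)//=; first by rewrite /F; lra.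
- exact: continuous_subspaceT.
- by split => //; [apply: cvg_at_right_filter|apply: cvg_at_left_filter];
    exact: F_continuous.
- by move=> z _; rewrite derive1E derive_val.
Qed.

End lebesgue_measure_itv.

Section measurable_invr_floor.
Context {R : realType}.

Lemma measurable_invr : measurable_fun [set: R] (@GRing.inv R).
Proof.
rewrite -(setvU [set 0 : R]); apply/measurable_funU => //.
  exact: measurableC.
split; last exact: measurable_fun_set1.
apply: open_continuous_measurable_fun; first exact/closed_openC/closed_eq.
by move=> x; rewrite inE /= => /eqP; exact: inv_continuous.
Qed.

Lemma measurable_floor :
  measurable_fun [set: R] (fun a : R => (Num.floor a)%:~R : R).
Proof.
by apply: nondecreasing_measurable => // x y xy; rewrite ler_int le_floor.
Qed.

End measurable_invr_floor.

Section fracpart.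
Context {R : realType}.
Implicit Types a : R.

Lemma fracpart_ge0 a : 0 <= fracpart a.
Proof. by rewrite subr_ge0 floor_le. Qed.

Lemma fracpart_lt1 a : fracpart a < 1.
Proof. by rewrite ltrBlDl -[1]/(1%:~R) -intrD floorD1_gt. Qed.

Lemma fracpart0 : fracpart (0 : R) = 0.
Proof. by rewrite /fracpart floor0 subrr. Qed.

Lemma measurable_fracpart : measurable_fun [set: R] (@fracpart R).
Proof. by apply: measurable_funB => //; exact: measurable_floor. Qed.

Lemma fracpart_continuous a : fracpart a != 0 ->
  {for a, continuous (@fracpart R)}.
Proof.
move=> a0.
have cvg_sub_floor : t - (Num.floor a)%:~R @[t --> a] --> fracpart a.
  by apply: cvgB; [exact: cvg_id|exact: cvg_cst].
apply: cvg_trans cvg_sub_floor; apply: near_eq_cvg.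
have floor_lt : (Num.floor a)%:~R < a.
  by rewrite -subr_gt0 lt_def a0 fracpart_ge0.
near=> t; congr (_ - _%:~R); apply/esym/floor_def/andP; split.
  by apply/ltW; near: t; exact: lt_nbhsr.
by near: t; apply: lt_nbhsl; exact: floorD1_gt.
Unshelve. all: by end_near. Qed.

Lemma ae_fracpart_neq0 x : x != 0 ->
  {ae @lebesgue_measure R, forall z : R, fracpart (x * z)^-1 != 0}.
Proof.
move=> x0; pose jumps : set R := range (fun m : int => (x * m%:~R)^-1).
have jumps_countable : countable jumps.
  exact: sub_countable (card_image_le _ _) (countableP _).
exists jumps; split; first exact: countable_measurable.
  exact: countable_lebesgue_measure0.
move=> z /= /negP/negPn; rewrite subr_eq0 => /eqP xz.
exists (Num.floor (x * z)^-1) => //.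
by rewrite -xz invfM invrK mulrA mulVf ?mul1r.
Qed.

End fracpart.

Section kernel.
Context {R : realType}.
Implicit Types x y z : R.

Lemma KC x y : K x y = K y x.
Proof. by rewrite /K andbC mulrC. Qed.

Lemma K_le0 x y : x <= 0 -> K x y = 0.
Proof. by rewrite /K ltNge => ->. Qed.

Lemma normr_K_le x y : `|K x y| <= 2^-1.
Proof.
rewrite /K; case: ifP => _; last by rewrite normr0 invr_ge0.
have := fracpart_ge0 (x * y)^-1; have := fracpart_lt1 (x * y)^-1.
by rewrite ler_norml => ? ?; apply/andP; split; lra.
Qed.

Lemma measurable_K x : measurable_fun [set: R] (K x).
Proof.
apply: measurable_fun_if => //.
  by apply: measurable_and => //; exact: measurable_fun_ltr.
apply: measurable_funTS; apply: measurable_funB => //.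
apply: (measurableT_comp measurable_fracpart).
exact: (measurableT_comp measurable_invr).
Qed.

Lemma K_continuous x z : fracpart (x * z)^-1 != 0 ->
  {for x, continuous (@K R ^~ z)}.
Proof.
move=> fxz.
have xz0 : x * z != 0 by apply: contraNneq fxz => ->; rewrite invr0 fracpart0.
have x0 : x != 0 by apply: contraNneq xz0 => ->; rewrite mul0r.
have near_pos : \forall t \near x, (0 < t) = (0 < x).
  have [x_gt0|x_lt0|x_0] := ltgtP 0 x; first exact: lt_nbhsr.
    by apply: filterS (lt_nbhsl x_lt0) => t /ltW; rewrite leNgt => /negbTE.
  by rewrite -x_0 eqxx in x0.
pose Kx t := if (0 < x) && (0 < z) then 2^-1 - fracpart (t * z)^-1 else 0.
have Kx_cvg : Kx t @[t --> x] --> K x z.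
  rewrite /Kx /K; case: ifP => _; last exact: cvg_cst.
  apply: cvgB; first exact: cvg_cst.
  apply: continuous_cvg; first exact: fracpart_continuous.
  by apply: cvgV => //; apply: cvgM; [exact: cvg_id|exact: cvg_cst].
apply: cvg_trans Kx_cvg; apply: near_eq_cvg.
by apply: filterS near_pos => t tx; rewrite /Kx /K tx.
Qed.

End kernel.

Section cells.
Context {R : realType}.
Local Notation mu := (@lebesgue_measure R).
Implicit Types (x z b M : R) (n : nat) (g : R -> R).

(* With [0^-1 = 0], [cell x 0] is empty for [0 < x], and [cell_top x z = 0] when
   [1 < x * z]. *)
Definition cell x n : interval R := `](x * n.+1%:R)^-1, (x * n%:R)^-1].

Definition cell_index x z : R := (Num.floor (x * z)^-1)%:~R.

Definition cell_top x z : R := (x * cell_index x z)^-1.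

Definition cell_sample g x z : R := g (cell_top x z).

(* The values of [K x] at the two ends of a cell are [- 2^-1], as a limit, and
   [2^-1]; the chord joins them. *)
Definition chordK x z : R :=
  let n := cell_index x z in n * (n + 1) * (x * z) - (n + 2^-1).

Lemma cell_index_bounds x z : 0 < x * z ->
  [/\ 0 <= cell_index x z, cell_index x z * (x * z) <= 1 &
      1 < (cell_index x z + 1) * (x * z)].
Proof.
move=> xz0; rewrite /cell_index; split.
- by rewrite ler0z floor_ge0 invr_ge0 ltW.
- by rewrite -ler_pdivlMr// div1r floor_le.
- by rewrite -ltr_pdivrMr// div1r -[1]/(1%:~R) -intrD floorD1_gt.
Qed.

Lemma cell_index_cell x z n : 0 < x -> (0 < n)%N -> z \in cell x n ->
  cell_index x z = n%:R.
Proof.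
rewrite in_itv/= => x0 n0 /andP[zl zr].
have xn0 : 0 < x * n%:R by rewrite mulr_gt0 ?ltr0n.
have z0 : 0 < z by apply: lt_trans zl; rewrite invr_gt0 mulr_gt0 ?ltr0n.
have xz0 : 0 < x * z by rewrite mulr_gt0.
rewrite /cell_index (@floor_def _ _ n%:Z)//.
rewrite -[(_ + 1)%:~R]/(n + 1)%:R addn1 -[n%:~R]/(n%:R).
rewrite -[n%:R]invrK -[n.+1%:R]invrK lef_pV2 ?ltf_pV2 ?posrE ?invr_gt0 ?ltr0n//.
by rewrite -ler_pdivlMl// -invfM zr -ltr_pdivrMl// -invfM.
Qed.

Lemma le_cell_top x z : 0 < x -> 0 <= z <= x^-1 -> z <= cell_top x z.
Proof.
move=> x0 /andP[z_ge0 zx]; have [->|z0] := eqVneq z 0.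
  by rewrite /cell_top /cell_index mulr0 invr0 floor0 mulr0 invr0.
have {z0 z_ge0} z0 : 0 < z by rewrite lt_def z0.
have xz0 : 0 < x * z by exact: mulr_gt0.
have [_ nxz nxz1] := cell_index_bounds xz0.
have xz1 : x * z <= 1 by rewrite mulrC -ler_pdivlMr// div1r.
have n0 : 0 < cell_index x z by nra.
rewrite -[leLHS]invrK lef_pV2 ?posrE ?invr_gt0 ?mulr_gt0//.
by rewrite -[leRHS]div1r ler_pdivlMr// mulrAC mulrC.
Qed.

Lemma cvg_cell_top z : 0 < z -> cell_top x z @[x --> 0^'+] --> z.
Proof.
move=> z0.
have x_fracpart0 : x * fracpart (x * z)^-1 @[x --> 0^'+] --> (0 : R).
  apply: (@squeeze_cvgr _ _ _ _ (cst 0) id); last 2 first.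
  - exact: cvg_cst.
  - exact: cvg_within.
  near=> x; have x0 : 0 < x by near: x; exact: nbhs_right_gt.
  rewrite mulr_ge0 ?fracpart_ge0 ?(ltW x0)//=.
  by rewrite ler_piMr ?(ltW x0)// ltW// fracpart_lt1.
have cvg_z : (z^-1 - x * fracpart (x * z)^-1)^-1 @[x --> 0^'+] --> z.
  have zV0 : z^-1 - 0 != 0 by rewrite subr0 invr_eq0 gt_eqF.
  have := cvgV zV0 (cvgB (cvg_cst z^-1) x_fracpart0).
  by rewrite subr0 invrK; exact.
apply: cvg_trans cvg_z; apply: near_eq_cvg; near=> x.
have x0 : 0 < x by near: x; exact: nbhs_right_gt.
rewrite /cell_top /cell_index /fracpart; congr (_^-1).
by move: (_%:~R) => m; field; rewrite !gt_eqF.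
Unshelve. all: by end_near. Qed.

Lemma normr_chordK_le x z : 0 <= x * z -> `|chordK x z| <= 2^-1.
Proof.
rewrite le_eqVlt => /predU1P[xz0|xz0].
  rewrite /chordK /cell_index -xz0 invr0 floor0.
  by rewrite mulr0 !add0r normrN ger0_norm.
have [n0 nxz nxz1] := cell_index_bounds xz0.
rewrite /chordK; move: (cell_index x z) n0 nxz nxz1 => n n0 nxz nxz1.
by rewrite ler_norml; apply/andP; split; nra.
Qed.

Lemma normr_K_sub_chordK_le x z : 0 < x -> 0 < z ->
  `|K x z - chordK x z| <= x * z.
Proof.
move=> x0 z0; set t := fracpart (x * z)^-1.
have t0 : 0 <= t by exact: fracpart_ge0.
have t1 : t < 1 by exact: fracpart_lt1.
have -> : K x z - chordK x z = t * (1 - t) * (x * z).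
  rewrite /K x0 z0 /chordK /cell_index /= /t /fracpart.
  by move: (_%:~R) => n; field; rewrite !gt_eqF.
have t1t0 : 0 <= t * (1 - t) by apply: mulr_ge0; lra.
have xz0 : 0 <= x * z by rewrite mulr_ge0 ?ltW.
rewrite ger0_norm; first by rewrite ler_piMl//; nra.
exact: mulr_ge0.
Qed.

Lemma measurable_cell_index x : measurable_fun [set: R] (cell_index x).
Proof.
apply: (measurableT_comp measurable_floor).
exact: (measurableT_comp measurable_invr).
Qed.

Lemma measurable_cell_top x : measurable_fun [set: R] (cell_top x).
Proof.
apply: (measurableT_comp measurable_invr).
by apply: measurable_funM => //; exact: measurable_cell_index.
Qed.

Lemma measurable_chordK x : measurable_fun [set: R] (chordK x).
Proof.
have measurable_index := measurable_cell_index x.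
apply: measurable_funB; last exact: measurable_funD.
apply: measurable_funM => //; apply: measurable_funM => //.
exact: measurable_funD.
Qed.

Lemma Rintegral_chordK_sample_cell g x n : 0 < x -> (0 < n)%N ->
  \int[mu]_(z in [set` cell x n]) (chordK x z * cell_sample g x z) = 0.
Proof.
move=> x0 n0.
have nR0 : 0 < n%:R :> R by rewrite ltr0n.
set c := g (x * n%:R)^-1.
transitivity (\int[mu]_(z in [set` cell x n])
    (- (n%:R + 2^-1) * c + n%:R * (n%:R + 1) * x * c * z)).
  apply: eq_Rintegral => z; rewrite inE /= => zn.
  rewrite /chordK /cell_sample /cell_top (cell_index_cell x0 n0 zn) -/c.
  by ring.
rewrite Rintegral_affine; last first.
  by rewrite ltf_pV2 ?posrE ?mulr_gt0// ltr_pM2l// ltr_nat.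
rewrite -[n.+1]addn1 natrD; field.
by rewrite !gt_eqF// addr_gt0.
Qed.

Section bounded_sample.
Variables (g : R -> R) (M : R).
Hypotheses (mg : measurable_fun [set: R] g) (gM : forall z, `|g z| <= M).

Lemma measurable_chordK_sample x :
  measurable_fun [set: R] (fun z => chordK x z * cell_sample g x z).
Proof.
apply: measurable_funM; first exact: measurable_chordK.
exact: (measurableT_comp mg (measurable_cell_top x)).
Qed.

Lemma normr_chordK_sample_le x z : 0 <= x * z ->
  `|chordK x z * cell_sample g x z| <= M / 2.
Proof.
move=> xz0; rewrite normrM mulrC.
by apply: ler_pM => //; [exact: gM|exact: normr_chordK_le].
Qed.

Lemma chordK_sample_integrable x b : 0 < x ->
  mu.-integrable `[0, b] (EFin \o (fun z => chordK x z * cell_sample g x z)).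
Proof.
move=> x0; apply: (@normr_le_integrable _ _ _ _ _ (M / 2)) => //.
- exact: lebesgue_measure_itvcc_lty.
- by apply: measurable_funTS; exact: measurable_chordK_sample.
- move=> z /=; rewrite in_itv/= => /andP[z0 _].
  by apply: normr_chordK_sample_le; rewrite mulr_ge0// ltW.
Qed.

Lemma Rintegral_chordK_sample_cells x n : 0 < x ->
  \int[mu]_(z in `](x * n.+1%:R)^-1, x^-1])
    (chordK x z * cell_sample g x z) = 0.
Proof.
move=> x0; elim: n => [|n IHn].
  by rewrite mulr1 set_itvoc0 Rintegral_set0.
have le_ends k m : (k <= m)%N -> (x * m.+1%:R)^-1 <= (x * k.+1%:R)^-1.
  by move=> km; rewrite lef_pV2 ?posrE ?mulr_gt0 ?ltr0n// ler_pM2l// ler_nat.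
have split_last := @Rintegral_itvB _ (fun z => chordK x z * cell_sample g x z)
  (BRight (x * n.+2%:R)^-1) (BRight x^-1) (x * n.+1%:R)^-1.
rewrite -IHn -split_last ?bnd_simp ?le_ends//.
- by rewrite Rintegral_chordK_sample_cell// subr0.
- apply: (integrableS _ _ _ (chordK_sample_integrable x^-1 x0)) => //.
  apply: subset_itvr; rewrite bnd_simp invr_ge0 mulr_ge0 ?ltW//.
- by have := le_ends _ _ (leq0n n); rewrite mulr1.
Qed.

Lemma Rintegral_chordK_sample x : 0 < x ->
  \int[mu]_(z in `[0, x^-1]) (chordK x z * cell_sample g x z) = 0.
Proof.
move=> x0; set f := fun z => chordK x z * cell_sample g x z.
have intf := chordK_sample_integrable x^-1 x0.
pose a_ n : R := (x * n.+1%:R)^-1.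
have a0 : a_ n @[n --> \oo] --> 0.
  under eq_fun do rewrite /a_ invfM.
  rewrite -[0](mulr0 x^-1); apply: cvgM; first exact: cvg_cst.
  exact: cvg_harmonic.
have head_eq n :
    \int[mu]_(z in `[0, a_ n]) f z = \int[mu]_(z in `[0, x^-1]) f z.
  apply/esym/eqP; rewrite -subr_eq0 Rintegral_itvB ?bnd_simp//.
  - by rewrite Rintegral_chordK_sample_cells.
  - by rewrite invr_ge0 mulr_ge0 ?ltW.
  - by rewrite lef_pV2 ?posrE ?mulr_gt0 ?ltr0n// ler_peMr ?(ltW x0)// ler1n.
have cvg_head : \int[mu]_(z in `[0, a_ n]) f z @[n --> \oo] --> (0 : R).
  have xV0 : 0 < x^-1 by rewrite invr_gt0.
  exact: (cvg_comp _ _ a0 (parameterized_integral_cvg_left xV0 intf)).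
apply/esym; apply: (cvg_unique _ cvg_head); first exact: Rhausdorff.
by apply: cvg_near_cst; exact: nearW.
Qed.

Lemma Rintegral_chordK_sample_support x b : 0 < x -> x * b <= 1 ->
  (forall z, b < z -> g z = 0) ->
  \int[mu]_(z in `[0, b]) (chordK x z * cell_sample g x z) = 0.
Proof.
move=> x0 xb1 g0.
have bx : b <= x^-1 by rewrite -div1r ler_pdivlMr// mulrC.
rewrite -[RHS](Rintegral_chordK_sample x0).
have sub0b : `[0, b] `<=` `[0, x^-1] by apply: subset_itvl; rewrite bnd_simp.
rewrite -(setIidr sub0b) Rintegral_mkcondr; apply: eq_Rintegral => z.
rewrite inE/= in_itv/= => zx; rewrite patchE; case: ifPn => //.
rewrite notin_setE/= in_itv/=; case/andP: zx => z0 zx.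
rewrite z0/= => /negP; rewrite -ltNge => bz.
by rewrite /cell_sample g0 ?mulr0// (lt_le_trans bz)// le_cell_top// z0.
Qed.

End bounded_sample.

Lemma cvg_K_sub_chordK_sample g h z : 0 < z -> h t @[t --> z] --> g z ->
  K x z * g z - chordK x z * cell_sample h x z @[x --> 0^'+] --> (0 : R).
Proof.
move=> z0 hg.
have hg_top : cell_sample h x z @[x --> 0^'+] --> g z.
  exact: (cvg_comp _ _ (cvg_cell_top z0) hg).
have : x * z * `|g z| + 2^-1 * `|g z - cell_sample h x z| @[x --> 0^'+] -->
    0 * z * `|g z| + 2^-1 * `|g z - g z|.
  apply: cvgD; apply: cvgM; try exact: cvg_cst.
    by apply: cvgM; [exact: cvg_within|exact: cvg_cst].
  by apply: cvg_norm; apply: cvgB => //; exact: cvg_cst.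
rewrite subrr normr0 !mul0r mulr0 addr0 => bound0.
apply/norm_cvg0P; apply: squeeze_cvgr (cvg_cst 0) bound0.
near=> x; have x0 : 0 < x by near: x; exact: nbhs_right_gt.
rewrite normr_ge0/= (_ : _ - _ = (K x z - chordK x z) * g z +
  chordK x z * (g z - cell_sample h x z)); last by ring.
rewrite (le_trans (ler_normD _ _))// !normrM lerD// ler_wpM2r//.
  exact: normr_K_sub_chordK_le.
by apply: normr_chordK_le; rewrite mulr_ge0// ltW.
Unshelve. all: by end_near. Qed.

End cells.

Section riemann_lebesgue.
Context {R : realType}.
Local Notation mu := (@lebesgue_measure R).
Variables (g : R -> R) (b M : R).
Hypotheses (b0 : 0 <= b) (mg : measurable_fun `[0, b] g).
Hypothesis gM : forall z, 0 <= z <= b -> `|g z| <= M.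

(* Cutting [g] off outside [0, b] discards the cell that [b] cuts in two. *)
Let h : R -> R := g \_ `[0, b].

Let measurable_h : measurable_fun [set: R] h.
Proof. exact/(measurable_restrictT _ _).1. Qed.

Let normr_h_le z : `|h z| <= M.
Proof.
rewrite /h patchE; case: ifPn => [|_]; first by rewrite inE/= in_itv/= => /gM.
by rewrite normr0 (le_trans _ (gM (z := 0) _))// lexx.
Qed.

Let measurable_K_mul x : measurable_fun `[0, b] (fun z => K x z * g z).
Proof.
by apply: measurable_funM => //; apply: measurable_funTS; exact: measurable_K.
Qed.

Let normr_K_mul_le x z : 0 <= z <= b -> `|K x z * g z| <= M / 2.
Proof.
move=> zb; rewrite normrM mulrC; apply: ler_pM => //; first exact: gM.
exact: normr_K_le.
Qed.

Lemma Rintegral_K_sub_chordK_sample x : 0 < x -> x * b <= 1 ->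
  \int[mu]_(z in `[0, b])
    (K x z * g z - chordK x z * cell_sample h x z) =
  \int[mu]_(z in `[0, b]) (K x z * g z).
Proof.
move=> x0 xb1; rewrite RintegralB//.
- rewrite (Rintegral_chordK_sample_support measurable_h normr_h_le) ?subr0//.
  move=> z bz.
  by rewrite /h patchE memNset//= in_itv/= (leNgt z b) bz andbF.
- apply: (normr_le_integrable (M := M / 2)) => //.
  + exact: lebesgue_measure_itvcc_lty.
  + exact: measurable_K_mul.
  + by move=> z; rewrite /= in_itv/=; exact: normr_K_mul_le.
- exact: (chordK_sample_integrable measurable_h normr_h_le).
Qed.

Lemma cvg_Rintegral_K_mul :
  {ae mu, forall z : R, 0 < z < b -> {for z, continuous g}} ->
  \int[mu]_(z in `[0, b]) (K x z * g z) @[x --> 0^'+] --> (0 : R).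
Proof.
move=> cg; apply/cvg_at_rightP => x_ [x0 x_0].
suff cvg_sub : \int[mu]_(z in `[0, b])
    (K (x_ n) z * g z - chordK (x_ n) z * cell_sample h (x_ n) z) @[n --> \oo]
    --> (0 : R).
  apply: cvg_trans cvg_sub; apply: near_eq_cvg.
  have xb0 : x_ n * b @[n --> \oo] --> 0.
    by rewrite -[0](mul0r b); apply: cvgM => //; exact: cvg_cst.
  have : \forall n \near \oo, x_ n * b <= 1 by exact: (cvgr_le 0).
  by apply: filterS => n; exact: Rintegral_K_sub_chordK_sample.
apply: (bounded_convergence0 (M := M)) => //.
- exact: lebesgue_measure_itvcc_lty.
- move=> n; apply: measurable_funB; first exact: measurable_K_mul.
  by apply: measurable_funTS; exact: measurable_chordK_sample.
- move=> n z /=; rewrite in_itv/= => zb; case/andP: (zb) => z0 _.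
  rewrite [M]splitr (le_trans (ler_normB _ _))// lerD ?normr_K_mul_le//.
  by apply: normr_chordK_sample_le => //; rewrite mulr_ge0// ltW.
apply: filterS3 cg (ae_neq (0 : R)) (ae_neq b).
  exact: (ae_filter_ringOfSetsType mu).
move=> z cgz zn0 znb /=; rewrite in_itv/= => /andP[z0 zb].
have {zn0 znb z0 zb} z0b : 0 < z < b by rewrite lt_def zn0 z0 lt_neqAle znb.
have hz : h t @[t --> z] --> g z.
  apply: cvg_patch; first by case/andP: z0b => /lt_trans; apply.
    by rewrite in_itv.
  apply: continuous_subspaceT_for (cgz z0b); rewrite /= in_itv/=.
  by case/andP: z0b => /ltW-> /ltW->.
have /andP[z0 _] := z0b.
by move/cvg_at_rightP: (cvg_K_sub_chordK_sample z0 hz); exact.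
Qed.

End riemann_lebesgue.

Section K2.
Context {R : realType}.
Local Notation mu := (@lebesgue_measure R).
Implicit Types x y : R.

Lemma K2C x y : K2 x y = K2 y x.
Proof. by apply: eq_Rintegral => z _; rewrite mulrC KC [K x z]KC. Qed.

Lemma K2_le0 x y : x <= 0 -> K2 x y = 0.
Proof.
move=> x0; rewrite -[RHS](mul0r (fine (mu `[0, 1]))) -Rintegral_cst//.
by apply: eq_Rintegral => z _; rewrite K_le0// mul0r.
Qed.

Lemma K_mul_integrable x y :
  mu.-integrable `[0, 1] (EFin \o (fun z => K x z * K z y)).
Proof.
apply: (normr_le_integrable (M := 2^-1 * 2^-1)) => //.
- exact: lebesgue_measure_itvcc_lty.
- apply: measurable_funTS; apply: measurable_funM; first exact: measurable_K.
  by under eq_fun do rewrite KC; exact: measurable_K.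
- by move=> z _; rewrite normrM ler_pM// normr_K_le.
Qed.

Lemma normr_K_sub_le y y' z : `|K y z - K y' z| <= 1.
Proof.
by rewrite (le_trans (ler_normB _ _))// [1]splitr div1r lerD// normr_K_le.
Qed.

Lemma measurable_normr_K_sub y y' (D : set R) :
  measurable_fun D (fun z => `|K y z - K y' z|).
Proof.
apply: measurable_funTS; apply: measurableT_comp => //.
by apply: measurable_funB; exact: measurable_K.
Qed.

Lemma normr_K_sub_integrable y y' :
  mu.-integrable `[0, 1] (EFin \o (fun z => `|K y z - K y' z|)).
Proof.
apply: (normr_le_integrable (M := 1)) => //.
- exact: lebesgue_measure_itvcc_lty.
- exact: measurable_normr_K_sub.
- by move=> z _; rewrite normr_id; exact: normr_K_sub_le.
Qed.

Lemma normr_K2B_le x y y' :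
  `|K2 x y - K2 x y'| <= \int[mu]_(z in `[0, 1]) `|K y z - K y' z|.
Proof.
have intB := integrableB _ (K_mul_integrable x y) (K_mul_integrable x y').
rewrite /K2 -RintegralB//; [|exact: K_mul_integrable..].
rewrite (le_trans (le_normr_Rintegral _ _))//; first exact: intB.
apply: le_Rintegral => //; first exact/integrable_norm/intB.
  exact: normr_K_sub_integrable.
move=> z _; rewrite -mulrBr normrM (KC z y) (KC z y') ler_piMl//.
by rewrite (le_trans (normr_K_le _ _))// invf_le1// ler1n.
Qed.

Lemma cvg_K_L1 y : y != 0 ->
  \int[mu]_(z in `[0, 1]) `|K t z - K y z| @[t --> y] --> (0 : R).
Proof.
move=> y0; apply/(@cvg_nbhsP _ R^o) => y_ y_y.
apply: (bounded_convergence0 (M := 1)) => //.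
- exact: lebesgue_measure_itvcc_lty.
- by move=> n; exact: measurable_normr_K_sub.
- by move=> n z _; rewrite normr_id; exact: normr_K_sub_le.
apply: filterS (ae_fracpart_neq0 y0).
  exact: (ae_filter_ringOfSetsType mu).
move=> z yz _; apply/norm_cvg0P/subr_cvg0.
exact: (continuous_cvg _ (K_continuous yz) y_y).
Qed.

Lemma cvg_K2_sub T (F : set_system T) {FF : Filter F} (f g : T -> R) y :
  y != 0 -> g t @[t --> F] --> y ->
  K2 (f t) (g t) - K2 (f t) y @[t --> F] --> 0.
Proof.
move=> y0 gy; apply/norm_cvg0P.
apply: squeeze_cvgr (cvg_cst 0) (cvg_comp _ _ gy (cvg_K_L1 y0)).
by apply: nearW => t; rewrite normr_ge0 normr_K2B_le.
Qed.

Lemma K2_continuousl y : continuous (@K2 R ^~ y).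
Proof.
have [->|y0] := eqVneq y 0.
  by under eq_fun do rewrite K2C K2_le0//; exact: cst_continuous.
move=> x; have [->|x0] := eqVneq x 0; last first.
  apply/subr_cvg0; under eq_fun do rewrite K2C [K2 x y]K2C.
  exact: (cvg_K2_sub (cst y) x0 cvg_id).
apply/left_right_continuousP; rewrite K2_le0//; split.
  apply: cvg_near_cst; near=> t.
  by rewrite K2_le0//; near: t; exact: nbhs_left_le.
apply: (cvg_Rintegral_K_mul (M := 2^-1)) => //.
- by apply: measurable_funTS; under eq_fun do rewrite KC; exact: measurable_K.
- by move=> z _; exact: normr_K_le.
- apply: filterS (ae_fracpart_neq0 y0).
    exact: (ae_filter_ringOfSetsType mu).
  by move=> z yz _; apply: K_continuous; rewrite mulrC.
Unshelve. all: by end_near. Qed.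

Lemma cvg_K2 T (F : set_system T) {FF : Filter F} (f g : T -> R) x y :
  y != 0 -> f t @[t --> F] --> x -> g t @[t --> F] --> y ->
  K2 (f t) (g t) @[t --> F] --> K2 x y.
Proof.
move=> y0 fx gy.
have fy : K2 (f t) y @[t --> F] --> K2 x y.
  exact: (continuous_cvg _ (@K2_continuousl y x) fx).
have := cvgD (cvg_K2_sub f y0 gy) fy; rewrite add0r.
by under eq_cvg do rewrite subrK; exact.
Qed.

Lemma K2_continuous (p : R * R) : p != 0 ->
  {for p, continuous (fun q : R * R => K2 q.1 q.2)}.
Proof.
case: p => x y xy0; have [y0|y0] := eqVneq y 0; last first.
  exact: (cvg_K2 y0 cvg_fst cvg_snd).
have x0 : x != 0 by apply: contraNneq xy0 => ->; rewrite y0.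
rewrite /prop_for/continuous_at/= K2C; under eq_cvg do rewrite K2C.
exact: (cvg_K2 x0 cvg_snd cvg_fst).
Qed.

End K2.

Theorem theorem2p7 (R : realType) :
  {within @D0 R, continuous (fun p : R * R => K2 p.1 p.2)}.
Proof.
apply: continuous_in_subspaceT => p; rewrite inE => -[_ [_ /eqP p0]].
exact: K2_continuous.
Qed.
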